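(* The problem \textsc{Prescribed NS-Foremost-path TGR} can be solved in $\mathcal{O}(n^2 m)$ time and $\mathcal{O}(n^2)$ space, where $m$ is the number of edges of the prescribed graph. Furthermore, if the instance is realizable, a realization with at most $n^2$ time labels in total can be computed within the same time and space bounds.
   Context: A temporal graph $\mathcal{G}=(G,\lambda)$ consists of a static undirected graph $G=(V,E)$ (its underlying graph) with $V=[n]$ and a labeling $\lambda:E\to 2^{\mathbb{N}_{>0}}$ assigning to each edge the (finite) set of positive times at which it appears; the number of time labels is $\sum_e|\lambda(e)|$. A non-strict temporal $uv$-path is a path $u=v_0,\dots,v_k=v$ in $G$ with distinct vertices and times $\tau_1\le\dots\le\tau_k$, $\tau_i\in\lambda(\{v_{i-1},v_i\})$; its arrival time is $\tau_k$. $\mathrm{NS}\text{-}\mathrm{Fo}(\mathcal{G})$ is the $n\times n$ matrix with diagonal $0$ and entry $(u,v)$, $u\ne v$, the minimum arrival time of a non-strict temporal $uv$-path ($\infty$ if none). A distance matrix is an $n\times n$ matrix with entries in $\mathbb{N}\cup\{\infty\}$, zero exactly on the diagonal. \textsc{Prescribed NS-Foremost-path TGR}: given $n$, an $n\times n$ distance matrix $D$ and a static graph $G_p=([n],E_p)$ (the prescribed graph), decide whether there exists a temporal graph $\mathcal{G}=(G,\lambda)$ on $[n]$ with $\mathrm{NS}\text{-}\mathrm{Fo}(\mathcal{G})=D$ and $G$ a subgraph of $G_p$. *)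

(* Defs.v *)
From HB Require Import structures.
From mathcomp Require Import all_boot all_algebra.
From mathcomp Require Import finmap boolp.

Set Implicit Arguments.
Unset Strict Implicit.
Unset Printing Implicit Defensive.

Record sgraph (n : nat) := SGraph {
  edges : {set {set 'I_n}};
  edges2 : [forall e in edges, #|e| == 2] }.

(* [labels e] is only meaningful for [e] in the edge set of [under]. *)
Record tgraph (n : nat) := TGraph {
  under : sgraph n;
  labels : {set 'I_n} -> {fset nat};
  labels_gt0 : forall e t, e \in edges under -> t \in labels e -> 0 < t }.

Definition nlabels (n : nat) (G : tgraph n) : nat :=
  \sum_(e in edges (under G)) #|` labels G e|.

Definition tedge (n : nat) (G : tgraph n) (x y : 'I_n) (t : nat) : bool :=
  ([set x; y] \in edges (under G)) && (t \in labels G [set x; y]).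

(* A path v_0, ..., v_k with times tau_1, ..., tau_k is given by its source v_0
   and the sequence (v_1, tau_1), ..., (v_k, tau_k). *)
Definition ns_path (n : nat) (G : tgraph n) (u v : 'I_n)
    (p : seq ('I_n * nat)) : bool :=
  [&& path (fun a b => tedge G a.1 b.1 b.2) (u, 0) p,
      uniq (u :: [seq a.1 | a <- p]),
      sorted leq [seq a.2 | a <- p] &
      last u [seq a.1 | a <- p] == v].

Definition arrival_time (p : seq nat) : nat := last 0 p.

Definition arrives (n : nat) (G : tgraph n) (u v : 'I_n) (t : nat) : Prop :=
  exists2 p, ns_path G u v p & arrival_time [seq a.2 | a <- p] = t.

(* [None] stands for infinity. *)
Definition foremost (n : nat) (G : tgraph n) (u v : 'I_n) : option nat :=
  if u == v then Some 0 else
  match pselect (exists t, `[< arrives G u v t >]) with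
  | left h => Some (ex_minn h)
  | right _ => None
  end.

Definition nsFo (n : nat) (G : tgraph n) : 'M[option nat]_n :=
  (\matrix_(u, v) foremost G u v)%R.

Definition distance_matrix (n : nat) (D : 'M[option nat]_n) : Prop :=
  forall u v, (D u v == Some 0) = (u == v).

Definition realization (n : nat) (D : 'M[option nat]_n) (Gp : sgraph n)
    (G : tgraph n) : Prop :=
  nsFo G = D /\ edges (under G) \subset edges Gp.

Definition realizable (n : nat) (D : 'M[option nat]_n) (Gp : sgraph n) : Prop :=
  exists G : tgraph n, realization D Gp G.

(* A unit-cost word RAM with structured control flow.  The finitely many
   registers mentioned by a program and the addressable memory cells hold words,
   i.e. natural numbers below [W]; only addresses below [S] may be accessed.
   Overflowing a word or leaving the memory is an error, for which [step], and
   hence [exec], yields no result. *)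

Inductive op := Add | Sub | Mul | Lt | Eq.

Definition eval_op (o : op) (a b : nat) : nat :=
  match o with
  | Add => a + b
  | Sub => a - b
  | Mul => a * b
  | Lt => a < b
  | Eq => a == b
  end.

Inductive instr :=
  | Const (x c : nat)              (* R[x] := c *)
  | Move (x y : nat)               (* R[x] := R[y] *)
  | Arith (o : op) (x y z : nat)   (* R[x] := R[y] o R[z] *)
  | Read (x y : nat)               (* R[x] := M[R[y]] *)
  | Write (x y : nat).             (* M[R[x]] := R[y] *)

Inductive prog :=
  | Skip
  | Do (i : instr)
  | Seq (p q : prog)
  | If (x : nat) (p q : prog)      (* [p] is selected when R[x] is nonzero *)
  | While (x : nat) (p : prog).    (* loops as long as R[x] is nonzero *)

Record state := State { reg : nat -> nat; mem : nat -> nat }.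

Definition set_reg (W x v : nat) (s : state) : option state :=
  if v < W then Some (State [eta reg s with x |-> v] (mem s)) else None.

Definition step (W S : nat) (i : instr) (s : state) : option state :=
  match i with
  | Const x c => set_reg W x c s
  | Move x y => set_reg W x (reg s y) s
  | Arith o x y z => set_reg W x (eval_op o (reg s y) (reg s z)) s
  | Read x y => if reg s y < S then set_reg W x (mem s (reg s y)) s else None
  | Write x y =>
      if reg s x < S
      then Some (State (reg s) [eta mem s with reg s x |-> reg s y]) else None
  end.

(* [exec W S p s t s']: started in [s], the program [p] halts in [s'] after [t]
   time units, one for every instruction and every test of a condition. *)
Inductive exec (W S : nat) : prog -> state -> nat -> state -> Prop :=
  | exec_skip s : exec W S Skip s 0 s
  | exec_do i s s' : step W S i s = Some s' -> exec W S (Do i) s 1 s'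
  | exec_seq p q s1 s2 s3 t1 t2 :
      exec W S p s1 t1 s2 -> exec W S q s2 t2 s3 ->
      exec W S (Seq p q) s1 (t1 + t2) s3
  | exec_if_true x p q s s' t :
      reg s x != 0 -> exec W S p s t s' -> exec W S (If x p q) s t.+1 s'
  | exec_if_false x p q s s' t :
      reg s x = 0 -> exec W S q s t s' -> exec W S (If x p q) s t.+1 s'
  | exec_while_false x p s :
      reg s x = 0 -> exec W S (While x p) s 1 s
  | exec_while_true x p s1 s2 s3 t1 t2 :
      reg s1 x != 0 -> exec W S p s1 t1 s2 -> exec W S (While x p) s2 t2 s3 ->
      exec W S (While x p) s1 (t1 + t2).+1 s3.

Definition init (input : seq nat) : state :=
  State (fun=> 0) (fun a => nth 0 input a).

(* Every edge is listed once, in an arbitrary order and orientation. *)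
Definition edge_list (n : nat) (G : sgraph n) (es : seq ('I_n * 'I_n)) : Prop :=
  perm_eq [seq [set e.1; e.2] | e <- es] (enum (edges G)).

Definition dist_code (d : option nat) : nat := if d is Some k then k.+1 else 0.

(* n, m, the rows of D one after the other, and the endpoints of the m edges *)
Definition encode (n : nat) (D : 'M[option nat]_n) (es : seq ('I_n * 'I_n)) :
    seq nat :=
  [:: n; size es] ++
  [seq dist_code (D u v) | u <- enum 'I_n, v <- enum 'I_n] ++
  flatten [seq [:: nat_of_ord e.1; nat_of_ord e.2] | e <- es].

(* The sequence [ls] of triples (u, v, t) lists the pairs of an edge {u, v} and
   a label t of it; repetitions are harmless as label sets are sets. *)
Definition label_list (n : nat) (G : tgraph n) (ls : seq ('I_n * 'I_n * nat)) :
    Prop :=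
  [seq ([set l.1.1; l.1.2], l.2) | l <- ls] =i
  [seq (e, t) | e <- enum (edges (under G)), t <- enum_fset (labels G e)].

(* Register 1 holds the address and register 2 the length of a label list of
   [G], stored as consecutive triples within the first [S] cells. *)
Definition outputs (n S : nat) (s : state) (G : tgraph n) : Prop :=
  exists ls : seq ('I_n * 'I_n * nat),
    [/\ label_list G ls, size ls = reg s 2, reg s 1 + 3 * reg s 2 <= S &
        [seq mem s a | a <- iota (reg s 1) (3 * reg s 2)] =
        flatten [seq [:: nat_of_ord l.1.1; nat_of_ord l.1.2; l.2] | l <- ls]].

(* The quantities n^2 m and n^2 of the resource bounds, with n and m replaced by
   1 when they are 0: already reading D takes n^2 steps when m = 0. *)
Definition time_bound (n m : nat) : nat := maxn 1 n ^ 2 * maxn 1 m.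
Definition space_bound (n : nat) : nat := maxn 1 n ^ 2.

(* Main.v *)
Require Import Defs.
From HB Require Import structures.
From mathcomp Require Import all_boot all_algebra.
From mathcomp Require Import finmap boolp.
From mathcomp Require Import zify.

Set Implicit Arguments.
Unset Strict Implicit.
Unset Printing Implicit Defensive.

(* In a realization, a label t on an edge xy is compatible with D: for every w,
   x is reached from w by time t iff y is.  Conversely, a labelling with
   compatible labels never has an earlier arrival than D, so it realizes D as
   soon as it attains every finite entry.  A foremost tree rooted at u only uses
   good arcs, that is, arcs x -> y of the prescribed graph whose edge is
   compatible with the label D u y; hence D is realizable iff for every u the
   set reached from u along good arcs is {v | D u v finite}.  Emitting the label
   D u y whenever y is first reached gives at most n - 1 labels for each u.  For
   a fixed u, deciding which arcs are good takes O(n) steps per arc, and the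
   search n rounds over all arcs: O(n^2 m) in total. *)

(** * Temporal walks, temporal paths and foremost arrival times *)

Inductive twalk (n : nat) (L : 'I_n -> 'I_n -> nat -> bool) (u : 'I_n) :
    'I_n -> nat -> Prop :=
  | twalk_nil : twalk L u u 0
  | twalk_step x y s t :
      twalk L u x s -> s <= t -> L x y t -> twalk L u y t.

Lemma twalk_sub (n : nat) (L L' : 'I_n -> 'I_n -> nat -> bool) u v t :
  (forall x y s, L x y s -> L' x y s) -> twalk L u v t -> twalk L' u v t.
Proof.
move=> sLL'; elim=> [|x y s r _ IH le_sr Lxy]; first exact: twalk_nil.
exact: twalk_step IH le_sr (sLL' _ _ _ Lxy).
Qed.

Definition le_opt (o : option nat) (t : nat) : bool :=
  if o is Some s then s <= t else false.

(** An entry is determined by its up-set of thresholds, which is empty for [None]. Matrix entries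
    are therefore compared threshold by threshold, with no case split on infinity. *)
Lemma le_opt_inj (o o' : option nat) :
  (forall t, le_opt o t = le_opt o' t) -> o = o'.
Proof.
case: o o' => [s|] [s'|] // H; first last.
- by have := H s'; rewrite /= leqnn.
- by have := H s; rewrite /= leqnn.
congr Some; apply/eqP; rewrite eqn_leq.
by have := H s; have := H s'; rewrite /= !leqnn => -> <-.
Qed.

Lemma sorted_rcons_leq (s : seq nat) (x : nat) :
  sorted leq (rcons s x) = sorted leq s && (last 0 s <= x).
Proof. by case: s => [|y s] //=; rewrite rcons_path. Qed.

Section TemporalPaths.
Variables (n : nat) (G : tgraph n).
Implicit Types (u v x y : 'I_n) (p : seq ('I_n * nat)).

Lemma ns_path_rcons u v p y t :
  ns_path G u v (rcons p (y, t)) =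
  [&& ns_path G u (last u [seq a.1 | a <- p]) p,
      tedge G (last u [seq a.1 | a <- p]) y t,
      y \notin u :: [seq a.1 | a <- p],
      arrival_time [seq a.2 | a <- p] <= t & y == v].
Proof.
rewrite /ns_path /arrival_time !map_rcons rcons_path sorted_rcons_leq last_rcons.
rewrite -rcons_cons rcons_uniq eqxx andbT.
have -> : (last (u, 0) p).1 = last u [seq a.1 | a <- p]
  by rewrite -[u in RHS]/(fst (u, 0)) (last_map fst).
case: (path _ _ _) => //=.
case: (tedge _ _ _ _); last by rewrite andbF.
case: (y \in _); rewrite ?andbF //=.
case: (u \in _); case: (uniq _); case: (sorted _ _); rewrite ?andbF //=.
Qed.

(** The path is cut at its visit of [y]; since the times are sorted, the prefix arrives no later
    than the whole. *)
Lemma ns_path_prefix u v p y :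
  ns_path G u v p -> y \in u :: [seq a.1 | a <- p] ->
  exists2 q, ns_path G u y q &
    arrival_time [seq a.2 | a <- q] <= arrival_time [seq a.2 | a <- p].
Proof.
elim/last_ind: p v => [|p [z t] IH] v.
  by rewrite inE => _ /eqP ->; exists [::] => //; rewrite /ns_path /= eqxx.
move=> pP; rewrite map_rcons -rcons_cons mem_rcons in_cons => /orP[/eqP -> /=|yp].
  by exists (rcons p (z, t)) => //; move: pP; rewrite !ns_path_rcons eqxx andbT
    => /and5P[-> -> -> ->].
move: pP; rewrite ns_path_rcons => /and5P[pP _ _ le_pt _].
have [q qP le_qp] := IH _ pP yp; exists q => //.
by rewrite [in leqRHS]map_rcons {2}/arrival_time last_rcons (leq_trans le_qp).
Qed.

(** Distinctness of vertices costs nothing: when a walk returns to a vertex [y] of the path built so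
    far, the path is cut at [y] instead of extended, and arrives no later. *)
Lemma twalk_ns_path u v t :
  twalk (tedge G) u v t ->
  exists2 p, ns_path G u v p & arrival_time [seq a.2 | a <- p] <= t.
Proof.
elim=> [|x y s r _ [p pP le_ps] le_sr Lxy].
  by exists [::] => //; rewrite /ns_path /= eqxx.
have le_pr := leq_trans le_ps le_sr.
have [yp|yp] := boolP (y \in u :: [seq a.1 | a <- p]).
  have [q qP le_qp] := ns_path_prefix pP yp.
  by exists q => //; apply: leq_trans le_qp le_pr.
have lastp : last u [seq a.1 | a <- p] = x by case/and4P: pP => _ _ _ /eqP.
exists (rcons p (y, r)); first by rewrite ns_path_rcons lastp pP Lxy yp le_pr /=.
by rewrite map_rcons /arrival_time last_rcons.
Qed.

Lemma ns_path_twalk u v p :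
  ns_path G u v p -> twalk (tedge G) u v (arrival_time [seq a.2 | a <- p]).
Proof.
elim/last_ind: p v => [|p [z t] IH] v.
  by case/and4P => _ _ _ /eqP <- /=; apply: twalk_nil.
rewrite ns_path_rcons => /and5P[/IH walkp Lz _ le_pt /eqP <-].
by rewrite map_rcons /arrival_time last_rcons; exact: twalk_step walkp le_pt Lz.
Qed.

(** This replaces the definition of [foremost] from here on. The empty walk, arriving at time 0,
    accounts for the diagonal. *)
Lemma foremost_le u v t :
  le_opt (foremost G u v) t <-> exists2 s, s <= t & twalk (tedge G) u v s.
Proof.
rewrite /foremost; have [<-|neq_uv] := eqVneq u v.
  by split=> // _; exists 0 => //; apply: twalk_nil.
case: pselect => [h|nh] /=; split=> //.
- case: ex_minnP => s /asboolP[p pP <-] _ le_st.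
  by exists (arrival_time [seq a.2 | a <- p]) => //; apply: ns_path_twalk.
- case=> s le_st /twalk_ns_path[p pP le_ps].
  case: ex_minnP => r _ /(_ (arrival_time [seq a.2 | a <- p])) le_r.
  by rewrite (leq_trans _ le_st) // (leq_trans _ le_ps) // le_r //; apply/asboolP; exists p.
- case=> s le_st /twalk_ns_path[p pP le_ps].
  by case: nh; exists (arrival_time [seq a.2 | a <- p]); apply/asboolP; exists p.
Qed.

Lemma tedge_sym x y t : tedge G x y t = tedge G y x t.
Proof. by rewrite /tedge setUC. Qed.

End TemporalPaths.

(** * Compatible labels and good arcs *)

Section Realizations.
Variables (n : nat) (D : 'M[option nat]_n).
Hypothesis D_dist : distance_matrix D.
Implicit Types (u v w x y : 'I_n) (G : tgraph n).

(* An edge xy may carry the label t iff crossing it at time t never beats D. *)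
Definition compat x y t : bool :=
  [forall w, le_opt (D w x) t == le_opt (D w y) t].

Lemma compat_sym x y t : compat x y t = compat y x t.
Proof. by apply: eq_forallb => w; rewrite eq_sym. Qed.

(** Whoever reaches one endpoint by time [t] can still cross at time [t], because paths are
    non-strict; the edge can be crossed both ways. *)
Lemma realization_compat G x y t : nsFo G = D -> tedge G x y t -> compat x y t.
Proof.
move=> GD; have le_xy a b : tedge G a b t -> forall w, le_opt (D w a) t -> le_opt (D w b) t.
  move=> Lab w; rewrite -GD !mxE => /foremost_le[s le_st walk_s].
  by apply/foremost_le; exists t => //; apply: twalk_step walk_s le_st Lab.
move=> Lxy; apply/forallP => w; apply/eqP; apply/idP/idP; first exact: le_xy.
by apply: le_xy; rewrite tedge_sym.
Qed.

(** Along the walk, compatibility at [w := u] carries the bound from the tail of each arc to its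
    head; it starts from [D u u = Some 0]. *)
Lemma twalk_compat_le (L : 'I_n -> 'I_n -> nat -> bool) u v t :
  (forall x y s, L x y s -> compat x y s) -> twalk L u v t -> le_opt (D u v) t.
Proof.
move=> Lc; elim=> {v t} [|x y s r _ le_s le_sr /Lc /forallP/(_ u) /eqP <-].
  by have := D_dist u u; rewrite eqxx => /eqP ->.
by case: (D u x) le_s => //= a le_as; apply: leq_trans le_sr.
Qed.

Lemma compat_realizes G :
  (forall x y t, tedge G x y t -> compat x y t) ->
  (forall u v t, D u v = Some t -> twalk (tedge G) u v t) -> nsFo G = D.
Proof.
move=> Gc GD; apply/matrixP => u v; rewrite mxE; apply: le_opt_inj => t.
apply/idP/idP.
  case/foremost_le => s le_st /(twalk_compat_le Gc).
  by case: (D u v) => //= r le_rs; apply: leq_trans le_st.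
case E: (D u v) => [s|] //= le_st.
by apply/foremost_le; exists s => //; apply: GD.
Qed.

Definition good u x y : bool :=
  if D u y is Some t then compat x y t else false.

(* Induction on D u v: the first edge of a foremost walk to v which leaves A
   carries the label D u v, hence is good. *)
Lemma good_closed_complete G u (A : {set 'I_n}) :
  nsFo G = D -> u \in A ->
  (forall x y, [set x; y] \in edges (under G) -> good u x y -> x \in A -> y \in A) ->
  forall v t, D u v = Some t -> v \in A.
Proof.
move=> GD uA closA v t; elim/ltn_ind: t v => t IH v Duv.
(* An inner induction along the walk puts all its vertices in [A], using the outer induction for
   those with an entry below [t]. *)
have walk_in y s : twalk (tedge G) u y s -> s <= t -> y \in A.
  elim=> // {y s} x y s r walk_x IHx le_sr Lxy le_rt.
  have [xA Cxy] := (IHx (leq_trans le_sr le_rt), realization_compat GD Lxy).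
  have : le_opt (D u y) r.
    by rewrite -GD mxE; apply/foremost_le; exists r => //; apply: twalk_step walk_x le_sr Lxy.
  case Duy: (D u y) => [q|] //= le_qr.
  have [lt_qt|le_tq] := ltnP q t; first exact: IH lt_qt _ Duy.
  (* Here [t <= q <= r <= t]: the arc is crossed exactly at time [D u y], so it is good. *)
  have eq_qr : q = r by lia.
  apply: (closA x) => //; first by case/andP: Lxy.
  by rewrite /good Duy eq_qr.
have : le_opt (D u v) t by rewrite Duv /=.
by rewrite -{1}GD mxE => /foremost_le[s le_st /walk_in]; apply.
Qed.

End Realizations.

(** * Temporal graphs given by lists of labels *)

Section LabelLists.
Variable n : nat.
Implicit Types (G : tgraph n) (ls : seq ('I_n * 'I_n * nat)).

Definition label_of (l : 'I_n * 'I_n * nat) : {set 'I_n} * nat :=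
  ([set l.1.1; l.1.2], l.2).

Lemma label_list_tedge G ls x y t :
  label_list G ls -> tedge G x y t = (([set x; y], t) \in map label_of ls).
Proof.
move=> /(_ ([set x; y], t)) ->; apply/andP/allpairsPdep => [[xyG txy]|].
  by exists [set x; y], t; rewrite mem_enum.
by case=> e [s [eG se [-> ->]]]; rewrite mem_enum in eG.
Qed.

(** The pairs counted by [nlabels] form a duplicate-free list, whereas [ls] may repeat a label;
    hence only an inequality. *)
Lemma nlabels_le_size G ls : label_list G ls -> nlabels G <= size ls.
Proof.
move=> Gls; rewrite -(size_map label_of ls).
have -> : nlabels G =
    size [seq (e, t) | e <- enum (edges (under G)), t <- enum_fset (labels G e)].
  by rewrite size_allpairs_dep sumnE big_map big_enum.
apply: uniq_leq_size => [|et]; last by rewrite -Gls.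
apply: allpairs_uniq_dep => [|e _|]; [exact: enum_uniq|exact: fset_uniq|].
by move=> [e t] [e' t'] _ _ /= [-> ->].
Qed.

(** The underlying graph consists of exactly the listed edges, so edges of [Gp] that received no
    label are dropped. *)
Lemma label_list_exists (Gp : sgraph n) ls :
  (forall l, l \in ls -> ([set l.1.1; l.1.2] \in edges Gp) && (0 < l.2)) ->
  exists2 G : tgraph n, label_list G ls & edges (under G) \subset edges Gp.
Proof.
move=> lsP.
pose E := [set e in [seq [set l.1.1; l.1.2] | l <- ls]].
have sEGp : E \subset edges Gp.
  by apply/subsetP => e; rewrite inE => /mapP[l /lsP/andP[lG _] ->].
have E2 : [forall e in E, #|e| == 2].
  apply/forall_inP => e /(subsetP sEGp) eG.
  exact: (forall_inP (edges2 Gp)).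
pose lab e : {fset nat} :=
  seq_fset tt [seq l.2 | l <- ls & [set l.1.1; l.1.2] == e].
have in_lab e t : (t \in enum_fset (lab e)) =
    (t \in [seq l.2 | l <- ls & [set l.1.1; l.1.2] == e]) by exact: seq_fsetE.
have lab0 e t : e \in edges (SGraph E2) -> t \in lab e -> 0 < t.
  move=> _; rewrite -[_ \in _]/(t \in enum_fset (lab e)) in_lab => /mapP[l].
  by rewrite mem_filter => /andP[_ /lsP/andP[_ ?]] ->.
exists (TGraph lab0) => // -[e t]; apply/mapP/allpairsPdep.
  case=> l l_ls [-> ->]; exists [set l.1.1; l.1.2], l.2; split=> //.
    by rewrite mem_enum inE; apply/mapP; exists l.
  by rewrite in_lab; apply/mapP; exists l; rewrite // mem_filter eqxx.
case=> e' [t' [_ + [-> ->]]]; rewrite in_lab => /mapP[l].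
by rewrite mem_filter => /andP[/eqP <- l_ls] ->; exists l.
Qed.

End LabelLists.

(** * Timed weakest preconditions for the word RAM *)

Definition block (ins : seq instr) : prog := foldr (fun i => Seq (Do i)) Skip ins.

Section WeakestPreconditions.
Variables W S : nat.
Implicit Types (P Q : state -> Prop) (p q : prog) (s : state).

(** Total correctness within a time budget: as errors yield no execution, absence of overflow and of
    stray accesses is part of every proof. *)
Definition wp p (T : nat) Q s : Prop :=
  exists t s', [/\ exec W S p s t s', t <= T & Q s'].

Lemma wp_conseq p T P Q s : (forall s', P s' -> Q s') -> wp p T P s -> wp p T Q s.
Proof. by move=> PQ [t [s' [? ? /PQ ?]]]; exists t, s'. Qed.

Lemma wp_seq p q T1 T2 Q s :
  wp p T1 (wp q T2 Q) s -> wp (Seq p q) (T1 + T2) Q s.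
Proof.
case=> t1 [s1 [ex1 le1 [t2 [s2 [ex2 le2 Q2]]]]].
by exists (t1 + t2), s2; split; [apply: exec_seq ex1 ex2|apply: leq_add|].
Qed.

(** The invariant is indexed by the number of completed iterations and fixes the loop register to
    [k < N], so there are exactly [N] iterations. Each costs its body plus one test, and the failing
    test adds 1. *)
Lemma wp_while (I : nat -> state -> Prop) N T x p s :
  (forall k s, I k s -> reg s x = (k < N)) ->
  (forall k s, k < N -> I k s -> wp p T (I k.+1) s) ->
  I 0 s -> wp (While x p) (N * T.+1).+1 (I N) s.
Proof.
move=> Ix Ip; suff loop d k s1 : k + d = N -> I k s1 ->
    wp (While x p) (d * T.+1).+1 (I N) s1 by apply: loop.
elim: d k s1 => [|d IH] k s1 eN Is1; have xs1 := Ix k s1 Is1.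
  have eqk : k = N by lia.
  rewrite -eqk; exists 1, s1; split=> //; apply: exec_while_false.
  by rewrite xs1 eqk ltnn.
have lt_kN : k < N by lia.
have [t1 [s2 [ex1 le1 Is2]]] := Ip _ _ lt_kN Is1.
have [|t2 [s3 [ex2 le2 Is3]]] := IH k.+1 s2 _ Is2; first by lia.
exists (t1 + t2).+1, s3; split=> //; last by rewrite mulSn; lia.
by apply: exec_while_true ex1 ex2; rewrite xs1 lt_kN.
Qed.

Fixpoint wpb (ins : seq instr) Q s : Prop :=
  if ins is i :: ins then exists2 s', step W S i s = Some s' & wpb ins Q s' else Q s.

Lemma wp_block ins Q s : wpb ins Q s -> wp (block ins) (size ins) Q s.
Proof.
elim: ins s => [|i ins IH] s /=; first by exists 0, s; split=> //; apply: exec_skip.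
case=> s' si /IH wp_is; rewrite -add1n; apply: wp_seq.
by exists 1, s'; split=> //; apply: exec_do.
Qed.

Lemma wpb_const x c ins Q r m :
  c < W -> wpb ins Q (State [eta r with x |-> c] m) ->
  wpb (Const x c :: ins) Q (State r m).
Proof. by move=> cW; exists (State [eta r with x |-> c] m); rewrite //= /set_reg cW. Qed.

(** The caller names the value [v], so that the symbolic state holds meaningful quantities instead
    of growing machine expressions. *)
Lemma wpb_arith v o x y z ins Q r m :
  eval_op o (r y) (r z) = v -> v < W ->
  wpb ins Q (State [eta r with x |-> v] m) ->
  wpb (Arith o x y z :: ins) Q (State r m).
Proof.
by move=> ev vW; exists (State [eta r with x |-> v] m); rewrite //= /set_reg ev vW.
Qed.

Lemma wpb_read a v x y ins Q r m :
  r y = a -> a < S -> m a = v -> v < W ->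
  wpb ins Q (State [eta r with x |-> v] m) ->
  wpb (Read x y :: ins) Q (State r m).
Proof.
move=> ra aS mv vW; exists (State [eta r with x |-> v] m) => //=.
by rewrite /set_reg ra aS mv vW.
Qed.

Lemma wpb_write a v x y ins Q r m :
  r x = a -> r y = v -> a < S ->
  wpb ins Q (State r [eta m with a |-> v]) ->
  wpb (Write x y :: ins) Q (State r m).
Proof.
by move=> ra rv aS; exists (State r [eta m with a |-> v]); rewrite //= ra rv aS.
Qed.

End WeakestPreconditions.

Arguments wpb : simpl never.

(** * The program *)

(* Registers: 0 answer, 1 address of the output, 2 number of emitted labels, 3 n,
   4 number 2m of arcs, 5 and 6 the constants 1 and 2, 7, 8, 9 the addresses of
   the edges, of the marks and of the table of good arcs, 10 loop condition,
   11 source u, 12 index j of the current arc x -> y, 13 and 20 running vertices,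
   14 x, 15 y, 16 the code of D u y, 17 whether the arc is good, 18 parity of j,
   19 round, 23 the constant 0, the others are scratch.  The arcs 2i and 2i+1 are
   the two orientations of edge i.  There are no branches: [relax_arc] always
   writes a triple after the last label, and adds the condition to the counter. *)
Definition load_arc : seq instr :=
  [:: Arith Add 21 7 12; Read 14 21; Arith Add 21 21 5; Arith Defs.Sub 21 21 18;
      Arith Defs.Sub 21 21 18; Read 15 21;
      Arith Mul 22 11 3; Arith Add 22 22 6; Arith Add 22 22 15; Read 16 22].

Definition next_arc : seq instr :=
  [:: Arith Defs.Sub 18 5 18; Arith Add 12 12 5; Arith Lt 10 12 4].

(** A vertex is not reached by the time in question if its code is 0 or exceeds the code in register
    16. These cases exclude each other, so the sums in registers 26 and 28 are booleans. *)
Definition check_step : seq instr :=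
  [:: Arith Mul 22 13 3; Arith Add 22 22 6;
      Arith Add 24 22 14; Read 24 24; Arith Add 25 22 15; Read 25 25;
      Arith Eq 26 24 23; Arith Lt 27 16 24; Arith Add 26 26 27;
      Arith Eq 28 25 23; Arith Lt 27 16 25; Arith Add 28 28 27;
      Arith Eq 26 26 28; Arith Mul 17 17 26;
      Arith Add 13 13 5; Arith Lt 10 13 3].

Definition test_arc : prog :=
  Seq (block (load_arc ++ [:: Arith Lt 17 23 16; Const 13 0; Arith Lt 10 13 3]))
 (Seq (While 10 (block check_step))
      (block ([:: Arith Add 21 9 12; Write 21 17] ++ next_arc))).

Definition clear_mark : seq instr :=
  [:: Arith Eq 24 20 11; Arith Add 21 8 20; Write 21 24;
      Arith Add 20 20 5; Arith Lt 10 20 3].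

(** Subtracting 1 in register 16 turns a code back into a label. For an infinite entry the result is
    a meaningless 0, but then the arc is not good and the triple is not counted. *)
Definition relax_arc : seq instr :=
  load_arc ++
  [:: Arith Add 21 9 12; Read 17 21; Arith Add 21 8 14; Read 24 21;
      Arith Add 25 8 15; Read 26 25;
      Arith Mul 17 17 24; Arith Defs.Sub 27 5 26; Arith Mul 17 17 27;
      Arith Add 21 2 2; Arith Add 21 21 2; Arith Add 21 1 21; Write 21 14;
      Arith Add 21 21 5; Write 21 15;
      Arith Add 21 21 5; Arith Defs.Sub 16 16 5; Write 21 16;
      Arith Add 2 2 17; Arith Add 26 26 17; Write 25 26] ++ next_arc.

Definition first_arc : seq instr := [:: Const 12 0; Const 18 0; Arith Lt 10 12 4].

Definition relax_round : prog :=
  Seq (block first_arc)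
 (Seq (While 10 (block relax_arc))
      (block [:: Arith Add 19 19 5; Arith Lt 10 19 3])).

Definition verify_mark : seq instr :=
  [:: Arith Mul 22 11 3; Arith Add 22 22 6; Arith Add 22 22 20; Read 16 22;
      Arith Lt 16 23 16; Arith Add 21 8 20; Read 24 21; Arith Eq 16 16 24;
      Arith Mul 0 0 16; Arith Add 20 20 5; Arith Lt 10 20 3].

Definition first_vertex : seq instr := [:: Const 20 0; Arith Lt 10 20 3].

Definition solve_source : prog :=
  Seq (block first_arc)
 (Seq (While 10 test_arc)
 (Seq (block first_vertex)
 (Seq (While 10 (block clear_mark))
 (Seq (block [:: Const 19 0; Arith Lt 10 19 3])
 (Seq (While 10 relax_round)
 (Seq (block first_vertex)
 (Seq (While 10 (block verify_mark))
      (block [:: Arith Add 11 11 5; Arith Lt 10 11 3])))))))).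

Definition setup : seq instr :=
  [:: Const 5 1; Const 6 2; Const 21 0; Const 23 0; Read 3 21; Read 4 5;
      Arith Add 4 4 4; Arith Mul 7 3 3; Arith Add 7 7 6; Arith Add 8 7 4;
      Arith Add 9 8 3; Arith Add 1 9 4; Const 2 0; Const 0 1;
      Const 11 0; Arith Lt 10 11 3].

Definition solve : prog := Seq (block setup) (While 10 solve_source).

Definition arcs n (es : seq ('I_n * 'I_n)) : seq ('I_n * 'I_n) :=
  flatten [seq [:: e; (e.2, e.1)] | e <- es].

(** As ['I_n] may be empty, a vertex [u] is passed to form the default pair. *)
Definition arc n (es : seq ('I_n * 'I_n)) (u : 'I_n) (j : nat) : 'I_n * 'I_n :=
  nth (u, u) (arcs es) j.

Definition triple n (l : 'I_n * 'I_n * nat) : seq nat :=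
  [:: nat_of_ord l.1.1; nat_of_ord l.1.2; l.2].

(** * Memory layout and the invariant shared by all loops *)

Section Run.
Variables (n : nat) (D : 'M[option nat]_n) (es : seq ('I_n * 'I_n)) (W S : nat).
Local Notation m := (size es).
Local Notation E := (n * n + 2).
Local Notation MARK := (E + (m + m)).
Local Notation OK := (MARK + n).
Local Notation OUT := (OK + (m + m)).
Variable inp : nat -> nat.
Hypothesis D_dist : distance_matrix D.
(** Room for [n * n] triples and one more, because [relax_arc] writes a triple even when it does not
    count it. *)
Hypothesis space : OUT + 3 * (n * n) + 3 <= S.
Hypothesis word : S <= W.
Hypothesis inpW : forall a, inp a < W.
Hypothesis inp0 : inp 0 = n.
Hypothesis inp1 : inp 1 = m.
Hypothesis inpD : forall u v : 'I_n, inp (u * n + 2 + v) = dist_code (D u v).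
Hypothesis inp_src : forall u j, j < m + m -> inp (E + j) = (arc es u j).1.
(** The target of arc [j] is in the other cell of its pair: the next cell for even [j], the previous
    one for odd [j]. Subtracting the parity twice covers both cases without a branch. *)
Hypothesis inp_dst : forall u j, j < m + m ->
  inp (E + j + 1 - odd j - odd j) = (arc es u j).2.

(** Here [b] is the answer so far, [out] the labels emitted so far and [k] the current source.
    Scratch registers, marks and the table of good arcs are left free, and the input stays
    intact. *)
Record base (b : bool) (out : seq ('I_n * 'I_n * nat)) (k : nat)
    (r mm : nat -> nat) : Prop := Base {
  base0 : r 0 = b;
  base1 : r 1 = OUT;
  base2 : r 2 = size out;
  base3 : r 3 = n;
  base4 : r 4 = m + m;
  base5 : r 5 = 1;
  base6 : r 6 = 2;
  base7 : r 7 = E;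
  base8 : r 8 = MARK;
  base9 : r 9 = OK;
  base11 : r 11 = k;
  base23 : r 23 = 0;
  base_in : forall a, a < MARK -> mm a = inp a;
  base_out : [seq mm a | a <- iota OUT (3 * size out)] =
             flatten [seq triple l | l <- out];
  base_size : size out <= n * n }.

Lemma base_frame b out k r r' mm :
  base b out k r mm ->
  (forall i, i \in [:: 0; 1; 2; 3; 4; 5; 6; 7; 8; 9; 11; 23] -> r' i = r i) ->
  base b out k r' mm.
Proof. by move=> B fr; case: B => *; split; rewrite ?fr. Qed.

Lemma base_write b out k r mm a v :
  base b out k r mm -> MARK <= a < OUT ->
  base b out k r [eta mm with a |-> v].
Proof.
case=> ? ? ? ? ? ? ? ? ? ? ? ? in_mm out_mm ? /andP[lea lta]; split=> //.
  by move=> i lti /=; rewrite ltn_eqF ?in_mm //; lia.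
rewrite -out_mm; apply/eq_in_map => i; rewrite mem_iota => /andP[lei _] /=.
by rewrite gtn_eqF //; lia.
Qed.

Ltac lookup :=
  rewrite /=;
  repeat match goal with H : ?r ?k = _ |- context [?r ?k] => is_var r; rewrite H end.

Lemma addr_lt (u v : 'I_n) : u * n + 2 + v < E.
Proof. by have := ltn_ord u; have := ltn_ord v; nia. Qed.

(** In continuation form: the remaining code sees an arbitrary register file that agrees with [r]
    outside five registers, which hides the intermediate updates. *)
Lemma wpb_load_arc b out (u : 'I_n) j r mm rest Q :
  base b out u r mm -> r 12 = j -> r 18 = odd j -> j < m + m ->
  (forall r', (forall i, i \notin [:: 14; 15; 16; 21; 22] -> r' i = r i) ->
    r' 14 = (arc es u j).1 -> r' 15 = (arc es u j).2 ->
    r' 16 = dist_code (D u (arc es u j).2) -> wpb W S rest Q (State r' mm)) ->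
  wpb W S (load_arc ++ rest) Q (State r mm).
Proof.
rewrite /load_arc /= => B r12 r18 lt_j K; have mm_in := base_in B.
have mS : (E + j < MARK) && (E + j + 1 - odd j - odd j < MARK) by lia.
case/andP: mS => lt1 lt2.
have := addr_lt u (arc es u j).2; set x := (arc es u j).1; set y := (arc es u j).2 => lt3.
have lt_y := ltn_ord y.
case: (B) => b0 b1 b2 b3 b4 b5 b6 b7 b8 b9 b11 b23 _ _ _.
apply: (@wpb_arith _ _ (E + j)); [by lookup|lia|].
apply: (@wpb_read _ _ (E + j) x); [by lookup|lia|by rewrite mm_in // (inp_src u)| |].
  by rewrite -(inp_src u).
apply: (@wpb_arith _ _ (E + j + 1)); [by lookup|lia|].
apply: (@wpb_arith _ _ (E + j + 1 - odd j)); [by lookup|lia|].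
apply: (@wpb_arith _ _ (E + j + 1 - odd j - odd j)); [by lookup|lia|].
apply: (@wpb_read _ _ (E + j + 1 - odd j - odd j) y); [by lookup|lia| | |].
- by rewrite mm_in // (inp_dst u).
- by rewrite -(inp_dst u).
apply: (@wpb_arith _ _ (u * n)); [by lookup|lia|].
apply: (@wpb_arith _ _ (u * n + 2)); [by lookup|lia|].
apply: (@wpb_arith _ _ (u * n + 2 + y)); [by lookup|lia|].
apply: (@wpb_read _ _ (u * n + 2 + y) (dist_code (D u y))); [by lookup|lia| | |].
- by rewrite mm_in ?inpD //; lia.
- by rewrite -inpD.
apply: K => //= i; rewrite !inE.
by do 5 case: (i == _).
Qed.

Ltac frame B :=
  apply: (base_frame B) => i; rewrite !inE; do ![case/orP|move/eqP->]; done.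

(** * Deciding which arcs are good *)

Lemma forall_ltS (P : pred 'I_n) (k : 'I_n) :
  [forall w : 'I_n, (w < k.+1) ==> P w] = [forall w : 'I_n, (w < k) ==> P w] && P k.
Proof.
apply/forallP/andP => [H|[/forallP H Pk] w].
  split; last by have := H k; rewrite ltnSn.
  by apply/forallP => w; apply/implyP => lt_wk; have := H w; rewrite ltnS (ltnW lt_wk).
apply/implyP; rewrite ltnS leq_eqVlt => /orP[/eqP/val_inj -> //|lt_wk].
by have := H w; rewrite lt_wk.
Qed.

(* Distance code 0 stands for infinity. *)
Definition code_le (a c : nat) : bool := (0 < a) && (a <= c).

Lemma code_leE o t : code_le (dist_code o) t.+1 = le_opt o t.
Proof. by case: o. Qed.

Definition same_side (x y : 'I_n) (c : nat) (w : 'I_n) : bool :=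
  code_le (dist_code (D w x)) c == code_le (dist_code (D w y)) c.

(** Finite codes are all shifted by 1, so comparing codes compares times. The vacuous bound [w < n]
    gives the form in which the check loop accumulates its conjunction. *)
Lemma goodE u x y :
  good D u x y = (0 < dist_code (D u y)) &&
    [forall w : 'I_n, (w < n) ==> same_side x y (dist_code (D u y)) w].
Proof.
rewrite /good; case: (D u y) => [t|] //=.
by apply: eq_forallb => w; rewrite ltn_ord /= /same_side !code_leE.
Qed.

Definition test_time : nat :=
  size load_arc + 3 + ((n * (size check_step).+1).+1 + 5).

Section Source.
Variables (b : bool) (u : 'I_n).
Local Notation src j := (arc es u j).1.
Local Notation dst j := (arc es u j).2.

Definition good_table (k : nat) (mm : nat -> nat) : Prop :=
  forall i, i < k -> mm (OK + i) = good D u (src i) (dst i).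

Definition check_inv out j mm (k : nat) (s : state) : Prop :=
  exists r, [/\ s = State r mm, base b out u r mm,
    [/\ r 10 = (k < n), r 13 = k, r 12 = j & r 18 = odd j],
    [/\ r 14 = src j, r 15 = dst j & r 16 = dist_code (D u (dst j))] &
    r 17 = (0 < dist_code (D u (dst j))) && [forall w : 'I_n,
      (w < k) ==> same_side (src j) (dst j) (dist_code (D u (dst j))) w]].

Lemma wp_check_step out j mm k s :
  k < n -> check_inv out j mm k s ->
  wp W S (block check_step) (size check_step) (check_inv out j mm k.+1) s.
Proof.
move=> lt_k [r [-> B [r10 r13 r12 r18] [r14 r15 r16] r17]].
apply: wp_block; rewrite /check_step.
case: (B) => b0 b1 b2 b3 b4 b5 b6 b7 b8 b9 b11 b23 mm_in _ _.
pose w := Ordinal lt_k; have := addr_lt w (src j); have := addr_lt w (dst j).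
move: r14 r15 r16 r17; set x := src j; set y := dst j; set c := dist_code _.
move=> r14 r15 r16 r17 /= lty ltx.
pose cx := dist_code (D w x); pose cy := dist_code (D w y).
have sp := space; have wd := word.
apply: (@wpb_arith _ _ (k * n)); [by lookup|lia|].
apply: (@wpb_arith _ _ (k * n + 2)); [by lookup|lia|].
apply: (@wpb_arith _ _ (k * n + 2 + x)); [by lookup|lia|].
apply: (@wpb_read _ _ (k * n + 2 + x) cx); [by lookup|lia| | |].
- by rewrite mm_in; [exact: (inpD w x)|lia].
- by rewrite /cx -inpD.
apply: (@wpb_arith _ _ (k * n + 2 + y)); [by lookup|lia|].
apply: (@wpb_read _ _ (k * n + 2 + y) cy); [by lookup|lia| | |].
- by rewrite mm_in; [exact: (inpD w y)|lia].
- by rewrite /cy -inpD.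
apply: (@wpb_arith _ _ (cx == 0)); [by lookup|lia|].
apply: (@wpb_arith _ _ (c < cx)); [by lookup|lia|].
apply: (@wpb_arith _ _ (~~ code_le cx c)); [rewrite /code_le; lookup; lia|lia|].
apply: (@wpb_arith _ _ (cy == 0)); [by lookup|lia|].
apply: (@wpb_arith _ _ (c < cy)); [by lookup|lia|].
apply: (@wpb_arith _ _ (~~ code_le cy c)); [rewrite /code_le; lookup; lia|lia|].
apply: (@wpb_arith _ _ (same_side x y c w)); [|lia|].
  by rewrite /same_side -/cx -/cy; lookup; case: code_le; case: code_le.
apply: (@wpb_arith _ _ ((0 < c) &&
    [forall w : 'I_n, (w < k.+1) ==> same_side x y c w])); [|lia|].
  by lookup; rewrite mulnb -andbA (forall_ltS _ w).
apply: (@wpb_arith _ _ k.+1); [by lookup; rewrite addn1|lia|].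
apply: (@wpb_arith _ _ (k.+1 < n)); [by lookup|lia|].
by eexists; split; [reflexivity|frame B| | |].
Qed.

Definition test_inv out (j : nat) (s : state) : Prop :=
  exists r mm, [/\ s = State r mm, base b out u r mm,
    [/\ r 10 = (j < m + m), r 12 = j & r 18 = odd j] & good_table j mm].

Lemma wp_test_arc out j s :
  j < m + m -> test_inv out j s -> wp W S test_arc test_time (test_inv out j.+1) s.
Proof.
move=> lt_j [r [mm [-> B [r10 r12 r18] tab]]].
have sp := space; have wd := word.
apply: wp_seq.
rewrite -[_ + 3]/(size (load_arc ++
  [:: Arith Lt 17 23 16; Const 13 0; Arith Lt 10 13 3])).
apply: wp_block; apply: (wpb_load_arc B r12 r18 lt_j) => r1 fr r14 r15 r16.
have {}B : base b out u r1 mm.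
  by apply: base_frame B _ => i; rewrite !inE => ?; rewrite fr // !inE; lia.
have {}r12 : r1 12 = j by rewrite fr.
have {}r18 : r1 18 = odd j by rewrite fr.
move: (B) => [b0 b1 b2 b3 b4 b5 b6 b7 b8 b9 b11 b23 _ _ _].
apply: (@wpb_arith _ _ (0 < dist_code (D u (dst j)))); [by lookup|lia|].
apply: wpb_const; first lia.
apply: (@wpb_arith _ _ (0 < n)); [by lookup|lia|].
apply: wp_seq; apply: (@wp_conseq _ _ _ _ (check_inv out j mm n)); last first.
  apply: wp_while => [k _ [r2 [-> _ [? _ _ _] _ _]] //|k s'|].
    exact: wp_check_step.
  eexists; split; [reflexivity|frame B|by []|by []|].
  by rewrite /= (_ : [forall w : 'I_n, _] = true) ?andbT //; apply/forallP.
move=> _ [r2 [-> {}B [_ _ {}r12 {}r18] _]]; rewrite -goodE => r17.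
move: (B) => [{}b0 {}b1 {}b2 {}b3 {}b4 {}b5 {}b6 {}b7 {}b8 {}b9 {}b11 {}b23 _ _ _].
rewrite -[5]/(size ([:: Arith Add 21 9 12; Write 21 17] ++ next_arc)).
apply: wp_block; rewrite /next_arc /=.
apply: (@wpb_arith _ _ (OK + j)); [by lookup|lia|].
apply: (@wpb_write _ _ (OK + j) (good D u (src j) (dst j))); [by []|by lookup|lia|].
apply: (@wpb_arith _ _ (odd j.+1)); [by lookup; case: odd|lia|].
apply: (@wpb_arith _ _ j.+1); [by lookup; rewrite addn1|lia|].
apply: (@wpb_arith _ _ (j.+1 < m + m)); [by lookup|lia|].
eexists; eexists; split; [reflexivity| |by []|].
  apply: base_write; last lia; frame B.
move=> i; rewrite ltnS leq_eqVlt /= eqn_add2l => /orP[/eqP ->|lt_ij]; first by rewrite eqxx.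
by rewrite ltn_eqF // tab.
Qed.

(** * Search along good arcs from one source *)

Definition marks (A : {set 'I_n}) (mm : nat -> nat) : Prop :=
  forall v : 'I_n, mm (MARK + v) = (v \in A).

Definition clear_inv out (k : nat) (s : state) : Prop :=
  exists r mm, [/\ s = State r mm, base b out u r mm, r 10 = (k < n), r 20 = k &
    good_table (m + m) mm /\ forall v : 'I_n, v < k -> mm (MARK + v) = (v == u)].

Lemma wp_clear_mark out k s :
  k < n -> clear_inv out k s ->
  wp W S (block clear_mark) (size clear_mark) (clear_inv out k.+1) s.
Proof.
move=> lt_k [r [mm [-> B r10 r20 [tab mk]]]].
have sp := space; have wd := word.
apply: wp_block; rewrite /clear_mark.
move: (B) => [b0 b1 b2 b3 b4 b5 b6 b7 b8 b9 b11 b23 _ _ _].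
apply: (@wpb_arith _ _ (k == u)); [by lookup|lia|].
apply: (@wpb_arith _ _ (MARK + k)); [by lookup|lia|].
apply: (@wpb_write _ _ (MARK + k) (k == u)); [by []|by lookup|lia|].
apply: (@wpb_arith _ _ k.+1); [by lookup; rewrite addn1|lia|].
apply: (@wpb_arith _ _ (k.+1 < n)); [by lookup|lia|].
eexists; eexists; split; [reflexivity| |by []|by []|split].
- by apply: base_write; last lia; frame B.
- by move=> i lt_i /=; rewrite gtn_eqF ?tab //; lia.
- move=> v; rewrite ltnS leq_eqVlt /= eqn_add2l => /orP[/eqP <-|lt_vk].
    by rewrite eqxx.
  by rewrite ltn_eqF // mk.
Qed.

(** The two conclusions serve the two outcomes of a relaxation: the new triple is ignored, or it is
    counted. *)
Lemma out_write (mm : nat -> nat) (l : seq ('I_n * 'I_n * nat)) (x y : 'I_n) (t : nat) :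
  let mm' := [eta [eta [eta mm with OUT + 3 * size l |-> nat_of_ord x]
    with OUT + 3 * size l + 1 |-> nat_of_ord y] with OUT + 3 * size l + 2 |-> t] in
  [seq mm a | a <- iota OUT (3 * size l)] = flatten (map (@triple n) l) ->
  [seq mm' a | a <- iota OUT (3 * size l)] = flatten (map (@triple n) l) /\
  [seq mm' a | a <- iota OUT (3 * (size l).+1)] =
    flatten (map (@triple n) (rcons l (x, y, t))).
Proof.
move=> mm' El.
have El' : [seq mm' a | a <- iota OUT (3 * size l)] = flatten (map (@triple n) l).
  rewrite -El; apply/eq_in_map => a; rewrite mem_iota => /andP[_ lta].
  by rewrite /mm' /= !ltn_eqF //; lia.
split=> //; rewrite mulnSr iotaD map_cat El' map_rcons -cats1 flatten_cat.
congr (_ ++ _); rewrite /mm' /= /triple /=.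
have -> : (OUT + 3 * size l).+2 = OUT + 3 * size l + 2 by lia.
have -> : (OUT + 3 * size l).+1 = OUT + 3 * size l + 1 by lia.
rewrite !eqxx !eqn_add2l /= !ifF //; lia.
Qed.

Lemma size_arcs : size (arcs es) = m + m.
Proof. by rewrite /arcs; elim: es => //= e es' ->; rewrite addnS. Qed.

Definition out_rel (out : seq ('I_n * 'I_n * nat)) (x y : 'I_n) (t : nat) : bool :=
  ([set x; y], t) \in map (@label_of n) out.

Lemma sub_out_rel out out' x y t :
  {subset out <= out'} -> out_rel out x y t -> out_rel out' x y t.
Proof. by rewrite /out_rel => sub /mapP[l /sub l_out ->]; apply: map_f. Qed.

Definition labels_ok (out : seq ('I_n * 'I_n * nat)) : Prop :=
  forall l, l \in out ->
    [/\ l.1 \in arcs es, 0 < l.2 & compat D l.1.1 l.1.2 l.2].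

Definition reached (out : seq ('I_n * 'I_n * nat)) (A : {set 'I_n}) : Prop :=
  u \in A /\ forall v, v \in A ->
    exists2 t, D u v = Some t & twalk (out_rel out) u v t.

(** Earlier sources account for at most [u * n] labels. The current one emits a label for each
    vertex of [A] except [u], hence the strict inequality. *)
Definition source_inv (out0 out : seq ('I_n * 'I_n * nat)) (A : {set 'I_n}) : Prop :=
  [/\ labels_ok out, reached out A, size out < u * n + #|A| &
      {subset out0 <= out}].

Lemma source_inv_relax out0 out A x y t :
  source_inv out0 out A -> (x, y) \in arcs es -> x \in A -> y \notin A ->
  good D u x y -> D u y = Some t ->
  source_inv out0 (rcons out (x, y, t)) (y |: A).
Proof.
move=> [ok [uA tr] sz sub] xy xA yA; rewrite /good => + Duy; rewrite Duy => cxy.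
have sub' : {subset out <= rcons out (x, y, t)}.
  by move=> l l_out; rewrite mem_rcons inE l_out orbT.
(* Only the diagonal of [D] is 0, and [y] differs from [u] because [u] lies in [A]. *)
have t_gt0 : 0 < t.
  have := D_dist u y; rewrite Duy; case: t {cxy sub' Duy} => // /esym/eqP eq_uy.
  by rewrite -eq_uy uA in yA.
split.
- by move=> l; rewrite mem_rcons inE => /orP[/eqP ->|/ok].
- split; first by rewrite !inE uA orbT.
  move=> v; rewrite !inE => /orP[/eqP ->|/tr[s Duv walk_v]]; last first.
    by exists s => //; apply: twalk_sub walk_v => ? ? ?; apply: sub_out_rel.
  exists t => //; have [s Dux walk_x] := tr _ xA.
  (* Compatibility at [w := u]: as [y] is due by time [t], so is [x], and the walk to [x] can be
     extended. *)
  have le_st : s <= t.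
    by have /forallP/(_ u) := cxy; rewrite Duy Dux /= leqnn => /eqP.
  apply: (@twalk_step _ _ _ x y s t) => //.
    by apply: twalk_sub walk_x => ? ? ?; apply: sub_out_rel.
  by rewrite /out_rel map_rcons mem_rcons inE eqxx.
- by rewrite size_rcons cardsU1 yA; lia.
- by move=> l /sub /sub'.
Qed.

Lemma source_inv_size out0 out A : source_inv out0 out A -> size out <= n * n.
Proof.
case=> _ _ lt_sz _; apply: leq_trans (ltnW lt_sz) _.
apply: (@leq_trans (u.+1 * n)); last by rewrite leq_mul2r ltn_ord orbT.
by rewrite mulSnr leq_add2l -[leqRHS]card_ord max_card.
Qed.

Definition closed_good (A : {set 'I_n}) : Prop :=
  forall i, i < m + m -> good D u (src i) (dst i) -> src i \in A -> dst i \in A.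

(** [A0] is the reached set at the start of the round, while [A] grows in place. Comparing the two
    at the end tells whether the search has become stationary. *)
Definition relax_inv out0 (A0 : {set 'I_n}) (q j : nat) (s : state) : Prop :=
  exists out A r mm, [/\ s = State r mm, base b out u r mm,
    [/\ r 10 = (j < m + m), r 12 = j, r 18 = odd j & r 19 = q],
    [/\ good_table (m + m) mm, marks A mm & source_inv out0 out A] &
    [/\ A0 \subset A, closed_good A0 -> A = A0 &
        forall i, i < j -> good D u (src i) (dst i) -> src i \in A0 -> dst i \in A]].

Ltac bound :=
  repeat match goal with H : _ = nat_of_bool _ |- _ => clear H end; lia.

Lemma wp_relax_arc out0 A0 q j s :
  j < m + m -> relax_inv out0 A0 q j s ->
  wp W S (block relax_arc) (size relax_arc) (relax_inv out0 A0 q j.+1) s.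
Proof.
move=> lt_j [out [A [r [mm [-> B [r10 r12 r18 r19] [tab mk inv] [sA0 clA0 cl]]]]]].
have sp := space; have wd := word.
apply: wp_block; rewrite /relax_arc.
apply: (wpb_load_arc B r12 r18 lt_j) => r1 fr r14 r15 r16.
have {}B : base b out u r1 mm.
  by apply: base_frame B _ => i; rewrite !inE => ?; rewrite fr // !inE; lia.
have {}r12 : r1 12 = j by rewrite fr.
have {}r18 : r1 18 = odd j by rewrite fr.
have {}r19 : r1 19 = q by rewrite fr.
have arc_j : (src j, dst j) \in arcs es by rewrite -surjective_pairing mem_nth ?size_arcs.
move: (B) => [b0 b1 b2 b3 b4 b5 b6 b7 b8 b9 b11 b23 _ b_out b_size].
have := tab j lt_j.
have inv' t := @source_inv_relax out0 out A (src j) (dst j) t inv arc_j.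
move: (cl) r14 r15 r16 inv'; set x := src j; set y := dst j; set c := dist_code _.
move=> _ r14 r15 r16 inv' tab_j.
have mk_x := mk x; have mk_y := mk y.
have [lt_x lt_y] := (ltn_ord x, ltn_ord y).
have c_lt : c < W by rewrite /c -inpD.
pose cond := [&& good D u x y, x \in A & y \notin A].
apply: (@wpb_arith _ _ (OK + j)); [by lookup|bound|].
apply: (@wpb_read _ _ (OK + j) (good D u x y)); [by lookup|bound|by []|bound|].
apply: (@wpb_arith _ _ (MARK + x)); [by lookup|bound|].
apply: (@wpb_read _ _ (MARK + x) (x \in A)); [by lookup|bound|by []|bound|].
apply: (@wpb_arith _ _ (MARK + y)); [by lookup|bound|].
apply: (@wpb_read _ _ (MARK + y) (y \in A)); [by lookup|bound|by []|bound|].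
apply: (@wpb_arith _ _ (good D u x y && (x \in A))); [by lookup; rewrite mulnb|bound|].
apply: (@wpb_arith _ _ (y \notin A)); [by lookup; case: (y \in A)|bound|].
apply: (@wpb_arith _ _ cond); [by lookup; rewrite mulnb -andbA|bound|].
apply: (@wpb_arith _ _ (2 * size out)); [by lookup; clear; lia|bound|].
apply: (@wpb_arith _ _ (3 * size out)); [by lookup; clear; lia|bound|].
apply: (@wpb_arith _ _ (OUT + 3 * size out)); [by lookup|bound|].
apply: (@wpb_write _ _ (OUT + 3 * size out) x); [by []|by lookup|bound|].
apply: (@wpb_arith _ _ (OUT + 3 * size out + 1)); [by lookup|bound|].
apply: (@wpb_write _ _ (OUT + 3 * size out + 1) y); [by []|by lookup|bound|].
apply: (@wpb_arith _ _ (OUT + 3 * size out + 2)); [by lookup; clear; lia|bound|].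
apply: (@wpb_arith _ _ c.-1); [by lookup; clear; lia|bound|].
apply: (@wpb_write _ _ (OUT + 3 * size out + 2) c.-1); [by []|by lookup|bound|].
apply: (@wpb_arith _ _ (size out + cond)); [by lookup|bound|].
apply: (@wpb_arith _ _ ((y \in A) || cond)).
- by lookup; rewrite /cond; case: (y \in A); rewrite ?andbF.
- bound.
apply: (@wpb_write _ _ (MARK + y) ((y \in A) || cond)); [by lookup|by lookup|bound|].
rewrite /next_arc.
apply: (@wpb_arith _ _ (odd j.+1)); [by lookup; case: odd|bound|].
apply: (@wpb_arith _ _ j.+1); [by lookup; rewrite addn1|bound|].
apply: (@wpb_arith _ _ (j.+1 < m + m)); [by lookup|bound|].
(* The branch-free code is now read as a conditional: adding [cond] to the counter and to the mark
   either accepts the triple just written or leaves it outside the output. *)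
pose out' := if cond then rcons out (x, y, c.-1) else out.
pose A' := if cond then y |: A else A.
have sAA' : A \subset A' by rewrite /A'; case: (cond); rewrite ?subsetUr.
have size_out' : size out' = size out + cond.
  by rewrite /out'; case: (cond); rewrite ?size_rcons ?addn1 ?addn0.
have {}inv' : source_inv out0 out' A'.
  rewrite /out' /A'; case E: (cond) => //; case/and3P: E => gxy xA yA.
  apply: inv' => //; move: gxy; rewrite /c /good; by case: (D u y).
have size_le : size out' <= n * n.
  exact: source_inv_size inv'.
have A'y : ((y \in A) || cond) = (y \in A').
  by rewrite /A'; case: (cond); rewrite ?orbF // !inE eqxx orbT.
rewrite A'y.
exists out', A'; eexists; eexists; split; [reflexivity| |by []| |].
- apply: base_write; last by clear - lt_y; lia.
  split=> //=.
  + move=> a lt_a; rewrite !ltn_eqF; [exact: (base_in B)|clear - lt_a; lia..].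
  + have [E1 E2] := out_write x y c.-1 b_out.
    rewrite size_out' /out'; case: (cond).
      by rewrite (addn1 (size out)).
    by rewrite (addn0 (size out)).
- split=> //.
  + move=> i lt_i /=;
    rewrite [OK + i == MARK + y]gtn_eqF; last by clear - lt_y; lia.
    by rewrite !ltn_eqF ?tab //; clear - lt_i; lia.
  + move=> v /=; rewrite eqn_add2l; case: eqP => [/val_inj -> //|/eqP neq_vy].
    have lt_v := ltn_ord v; rewrite !ltn_eqF; [|clear - lt_v; lia..].
    rewrite mk /A'.
    case: (cond) => //; rewrite !inE; congr nat_of_bool.
    by case: eqP => // eq_vy; rewrite eq_vy eqxx in neq_vy.
- split; first exact: subset_trans sAA'.
    move=> cl0; have eqA := clA0 cl0; rewrite /A'; case E: (cond) => //.
    case/and3P: E => gxy; rewrite eqA => xA; case/negP.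
    exact: cl0 lt_j gxy xA.
  move=> i; rewrite ltnS leq_eqVlt => /orP[/eqP -> |lt_ij] gi si; last first.
    by apply: (subsetP sAA'); apply: cl gi si.
  rewrite -/y -A'y /cond gi.
  by rewrite (subsetP sA0 _ si) /= orbN.
Qed.

(** Each round adds a vertex unless the set is already closed, so the second alternative becomes
    impossible at [k = n]. *)
Definition rounds_inv out0 (k : nat) (s : state) : Prop :=
  exists out A r mm, [/\ s = State r mm, base b out u r mm,
    r 10 = (k < n) /\ r 19 = k,
    [/\ good_table (m + m) mm, marks A mm & source_inv out0 out A] &
    closed_good A \/ k < #|A|].

Definition round_time : nat := 3 + (((m + m) * (size relax_arc).+1).+1 + 2).

Lemma wp_relax_round out0 k s :
  k < n -> rounds_inv out0 k s ->
  wp W S relax_round round_time (rounds_inv out0 k.+1) s.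
Proof.
move=> lt_k [out [A [r [mm [-> B [r10 r19] [tab mk inv] clA]]]]].
have sp := space; have wd := word.
apply: wp_seq; rewrite -[3]/(size first_arc); apply: wp_block; rewrite /first_arc.
move: (B) => [b0 b1 b2 b3 b4 b5 b6 b7 b8 b9 b11 b23 _ _ _].
apply: wpb_const; first by clear - sp wd; lia.
apply: wpb_const; first by clear - sp wd; lia.
apply: (@wpb_arith _ _ (0 < m + m)); [by lookup|clear - sp wd; lia|].
apply: wp_seq; apply: (@wp_conseq _ _ _ _ (relax_inv out0 A k (m + m))); last first.
  apply: wp_while => [j _ [? [? [? [? [-> _ [? _ _ _] _ _]]]]] //|j s'|].
    exact: wp_relax_arc.
  by exists out, A; eexists; exists mm; split; [reflexivity|frame B| | |].
move=> _ [out1 [A1 [r1 [mm1 [-> {}B [_ _ _ {}r19] [tab1 mk1 inv1] [sAA1 stab1 cl1]]]]]].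
move: (B) => [{}b0 {}b1 {}b2 {}b3 {}b4 {}b5 {}b6 {}b7 {}b8 {}b9 {}b11 {}b23 _ _ _].
rewrite -[2]/(size [:: Arith Add 19 19 5; Arith Lt 10 19 3]); apply: wp_block.
apply: (@wpb_arith _ _ k.+1); [by lookup; rewrite addn1|clear - sp wd lt_k; lia|].
apply: (@wpb_arith _ _ (k.+1 < n)); [by lookup|clear - sp wd; lia|].
exists out1, A1; eexists; exists mm1; split; [reflexivity|frame B|by []|by []|].
(* A round without change certifies closure. Otherwise [A] was not closed, and it grows strictly. *)
have [eqA|neqA] := eqVneq A1 A.
  by left=> i lt_i gi; move: (cl1 i lt_i gi); rewrite eqA.
case: clA => [/stab1/eqP|ltA]; first by rewrite (negPf neqA).
by right; apply: leq_ltn_trans ltA (proper_card _); rewrite properEneq eq_sym neqA.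
Qed.

(** * Comparing the reached set with the finite entries *)

Definition verify_inv b0 out (A : {set 'I_n}) (k : nat) (s : state) : Prop :=
  exists r mm, [/\ s = State r mm,
    base (b0 && [forall v : 'I_n, (v < k) ==> ((0 < dist_code (D u v)) == (v \in A))])
      out u r mm, r 10 = (k < n), r 20 = k & marks A mm].

Lemma wp_verify_mark b0 out A k s :
  k < n -> verify_inv b0 out A k s ->
  wp W S (block verify_mark) (size verify_mark) (verify_inv b0 out A k.+1) s.
Proof.
move=> lt_k [r [mm [-> B r10 r20 mk]]].
have sp := space; have wd := word.
apply: wp_block; rewrite /verify_mark; move: (B).
set b1 := b0 && _.
move=> [c0 c1 c2 c3 c4 c5 c6 c7 c8 c9 c11 c23 mm_in _ _].
pose v := Ordinal lt_k; have lt_a := addr_lt u v.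
have lt_u := ltn_ord u; have mk_v : mm (MARK + k) = (v \in A) by rewrite -mk.
apply: (@wpb_arith _ _ (u * n)); [by lookup|clear - sp wd lt_a; lia|].
apply: (@wpb_arith _ _ (u * n + 2)); [by lookup|clear - sp wd lt_a; lia|].
apply: (@wpb_arith _ _ (u * n + 2 + k)); [by lookup|clear - sp wd lt_a; simpl in *; lia|].
apply: (@wpb_read _ _ (u * n + 2 + k) (dist_code (D u v)));
  [by lookup|clear - sp wd lt_a; simpl in *; lia| | |].
- by rewrite mm_in; [exact: (inpD u v)|clear - sp wd lt_a; simpl in *; lia].
- by rewrite -inpD.
apply: (@wpb_arith _ _ (0 < dist_code (D u v))); [by lookup|clear - sp wd; lia|].
apply: (@wpb_arith _ _ (MARK + k)); [by lookup|clear - sp wd lt_k; lia|].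
apply: (@wpb_read _ _ (MARK + k) (v \in A));
  [by lookup|clear - sp wd lt_k; lia|by []|clear - sp wd; lia|].
apply: (@wpb_arith _ _ ((0 < dist_code (D u v)) == (v \in A))); [|clear - sp wd; lia|].
  by lookup; case: (v \in A); case: (0 < _).
apply: (@wpb_arith _ _ (b0 && [forall v : 'I_n, (v < k.+1) ==>
    ((0 < dist_code (D u v)) == (v \in A))])); [|clear - sp wd; lia|].
  rewrite (forall_ltS (fun v => (0 < dist_code (D u v)) == (v \in A)) v).
  by lookup; rewrite mulnb /b1 andbA.
apply: (@wpb_arith _ _ k.+1); [by lookup; rewrite addn1|clear - sp wd lt_k; lia|].
apply: (@wpb_arith _ _ (k.+1 < n)); [by lookup|clear - sp wd; lia|].
eexists; eexists; split; [reflexivity| |by []|by []|by []].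
case: B => *; split=> //.
Qed.

End Source.

(** * The loop over all sources *)

Variable Gp : sgraph n.
Hypothesis edges_arcs : forall x y, ([set x; y] \in edges Gp) = ((x, y) \in arcs es).

Lemma closed_complete (u : 'I_n) (A : {set 'I_n}) v t :
  realizable D Gp -> u \in A -> closed_good u A -> D u v = Some t -> v \in A.
Proof.
move=> [G [GD /subsetP sG]] uA clA; apply: (good_closed_complete GD uA) => x y.
move=> /sG; rewrite edges_arcs => xy_arc gxy xA.
have lt_i : index (x, y) (arcs es) < m + m by rewrite -size_arcs index_mem.
have := clA _ lt_i; rewrite /arc nth_index //=; exact.
Qed.

(** Labels of all sources accumulate in one list. This is harmless: compatibility quantifies over
    every source, so no emitted label can beat [D] elsewhere. *)
Definition solve_inv (k : nat) (s : state) : Prop :=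
  exists b out r mm, [/\ s = State r mm, base b out k r mm, r 10 = (k < n),
    labels_ok out /\ size out <= k * n &
    (b -> forall (u v : 'I_n) t, u < k -> D u v = Some t -> twalk (out_rel out) u v t) /\
    (realizable D Gp -> b)].

Definition source_time : nat :=
  3 + (((m + m) * test_time.+1).+1 + (2 + ((n * (size clear_mark).+1).+1 +
  (2 + ((n * round_time.+1).+1 + (2 + ((n * (size verify_mark).+1).+1 + 2))))))).

Ltac small := clear - space word; lia.

Lemma wp_solve_source k s :
  k < n -> solve_inv k s -> wp W S solve_source source_time (solve_inv k.+1) s.
Proof.
move=> lt_k [b [out [r [mm [-> B r10 [ok sz] [snd cpl]]]]]].
pose u := Ordinal lt_k; have {}B : base b out u r mm by [].
rewrite /solve_source /source_time; apply: wp_seq.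
rewrite -[3]/(size first_arc); apply: wp_block.
move: (B) => [b0 b1 b2 b3 b4 b5 b6 b7 b8 b9 b11 b23 _ _ _].
apply: wpb_const; first small.
apply: wpb_const; first small.
apply: (@wpb_arith _ _ (0 < m + m)); [by lookup|small|].
apply: wp_seq; apply: (@wp_conseq _ _ _ _ (test_inv b u out (m + m))); last first.
  apply: wp_while => [j _ [? [? [-> _ [? _ _] _]]] //|j s'|]; first exact: wp_test_arc.
  by eexists; exists mm; split; [reflexivity|frame B|split|].
move=> _ [{r10 b0 b1 b2 b3 b4 b5 b6 b7 b8 b9 b11 b23} r [{}mm [-> {}B _ tab]]].
move: (B) => [b0 b1 b2 b3 b4 b5 b6 b7 b8 b9 b11 b23 _ _ _].
apply: wp_seq; rewrite -[X in wp _ _ _ X]/(size first_vertex); apply: wp_block.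
apply: wpb_const; first small.
apply: (@wpb_arith _ _ (0 < n)); [by lookup|small|].
apply: wp_seq; apply: (@wp_conseq _ _ _ _ (clear_inv b u out n)); last first.
  apply: wp_while => [j _ [? [? [-> _ ? _ _]]] //|j s'|]; first exact: wp_clear_mark.
  by eexists; exists mm; split; [reflexivity|frame B| | |].
move=> _ [{r b0 b1 b2 b3 b4 b5 b6 b7 b8 b9 b11 b23} r [{tab}mm [-> {}B _ _ [tab mk]]]].
move: (B) => [b0 b1 b2 b3 b4 b5 b6 b7 b8 b9 b11 b23 _ _ _].
apply: wp_seq; rewrite -[X in wp _ _ _ X]/(size [:: Const 19 0; Arith Lt 10 19 3]).
apply: wp_block.
apply: wpb_const; first small.
apply: (@wpb_arith _ _ (0 < n)); [by lookup|small|].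
apply: wp_seq; apply: (@wp_conseq _ _ _ _ (rounds_inv b u out n)); last first.
  apply: wp_while => [j _ [? [? [? [? [-> _ [? _] _ _]]]]] //|j s'|]; first exact: wp_relax_round.
  exists out, [set u]; eexists; exists mm; split; [reflexivity|frame B|by []| |].
    split=> // [v|]; first by rewrite mk // inE.
    split=> //; last by rewrite cards1 addn1 ltnS.
    split=> [|v]; rewrite inE // => /eqP ->; exists 0; last exact: twalk_nil.
    by apply/eqP; rewrite D_dist.
  by right; rewrite cards1.
move=> _ [out1 [A [{r b0 b1 b2 b3 b4 b5 b6 b7 b8 b9 b11 b23} r [{tab mk}mm
  [-> {}B _ [tab mk [ok1 [uA reach] sz1 sub1]] clA]]]]].
(* After [n] rounds, the other alternative would give [A] more than [n] vertices. *)
have {}clA : closed_good u A.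
  by case: clA => //; rewrite ltnNge -[X in _ <= X]card_ord max_card.
move: (B) => [b0 b1 b2 b3 b4 b5 b6 b7 b8 b9 b11 b23 _ _ _].
apply: wp_seq; rewrite -[X in wp _ _ _ X]/(size first_vertex); apply: wp_block.
apply: wpb_const; first small.
apply: (@wpb_arith _ _ (0 < n)); [by lookup|small|].
apply: wp_seq; apply: (@wp_conseq _ _ _ _ (verify_inv u b out1 A n)); last first.
  apply: wp_while => [j _ [? [? [-> _ ? _ _]]] //|j s'|]; first exact: wp_verify_mark.
  eexists; exists mm; split; [reflexivity| |by []|by []|by []].
  rewrite (_ : [forall v : 'I_n, _] = true) ?andbT; last exact/forallP.
  frame B.
move=> _ [{r b0 b1 b2 b3 b4 b5 b6 b7 b8 b9 b11 b23} r [{tab mk}mm [-> {}B _ _ mk]]].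
move: B; set b' := b && _ => B.
move: (B) => [b0 b1 b2 b3 b4 b5 b6 b7 b8 b9 b11 b23 _ _ _].
rewrite -[X in wp _ _ _ X]/(size [:: Arith Add 11 11 5; Arith Lt 10 11 3]); apply: wp_block.
apply: (@wpb_arith _ _ k.+1); [by lookup; rewrite addn1|clear - space word lt_k; lia|].
apply: (@wpb_arith _ _ (k.+1 < n)); [by lookup|small|].
exists b', out1; eexists; exists mm; split; [reflexivity| |by []| |].
- by case: B => *; split.
- split=> //; apply: leq_trans (ltnW sz1) _; rewrite mulSnr leq_add2l.
  by rewrite -[leqRHS]card_ord max_card.
split=> [/andP[bT /forallP all_v] w v t|real].
  rewrite ltnS leq_eqVlt => /orP[eq_wk|lt_wk] Dwv.
    have eq_wu : w = u by apply/val_inj/eqP.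
    have := all_v v; rewrite ltn_ord /= -eq_wu Dwv /= => /eqP/esym vA.
    by have [t' ] := reach v vA; rewrite -eq_wu Dwv => -[->].
  by apply: twalk_sub (snd bT w v t lt_wk Dwv) => ? ? ?; apply: sub_out_rel.
(* On a realizable instance the check passes: reached vertices have finite entries by [reach], and
   the converse is [closed_complete]. *)
rewrite /b' cpl //=; apply/forallP => v; apply/implyP => _.
case vA: (v \in A); first by have [t -> _] := reach v vA.
case Duv: (D u v) => [t|] //.
by rewrite (closed_complete real uA clA Duv) in vA.
Qed.

Definition solve_time : nat := size setup + (n * source_time.+1).+1.

Lemma wp_solve : wp W S solve solve_time (solve_inv n) (State (fun=> 0) inp).
Proof.
have nW := inpW 0; have mW := inpW 1; rewrite inp0 in nW; rewrite inp1 in mW.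
apply: wp_seq; apply: wp_block; rewrite /setup.
apply: wpb_const; first small.
apply: wpb_const; first small.
apply: wpb_const; first small.
apply: wpb_const; first small.
apply: (@wpb_read _ _ 0 n); [by []|small|by []|by []|].
apply: (@wpb_read _ _ 1 m); [by []|small|by []|by []|].
apply: (@wpb_arith _ _ (m + m)); [by []|small|].
apply: (@wpb_arith _ _ (n * n)); [by []|small|].
apply: (@wpb_arith _ _ E); [by []|small|].
apply: (@wpb_arith _ _ MARK); [by []|small|].
apply: (@wpb_arith _ _ OK); [by []|small|].
apply: (@wpb_arith _ _ OUT); [by []|small|].
apply: wpb_const; first small.
apply: wpb_const; first small.
apply: wpb_const; first small.
apply: (@wpb_arith _ _ (0 < n)); [by []|small|].
apply: wp_while => [k _ [? [? [? [? [-> _ ? _ _]]]]] //|k s|]; first exact: wp_solve_source.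
by exists true, [::]; eexists; exists inp.
Qed.

End Run.

(** * The encoded input *)

Section Encoding.
Variables (n : nat) (D : 'M[option nat]_n) (Gp : sgraph n) (es : seq ('I_n * 'I_n)).
Local Notation m := (size es).

Lemma nth_flatten_const (T : Type) (x0 : T) (k : nat) (ss : seq (seq T)) i j :
  all (fun s => size s == k) ss -> j < k ->
  nth x0 (flatten ss) (i * k + j) = nth x0 (nth [::] ss i) j.
Proof.
elim: ss i => [|s ss IH] [|i] /=; rewrite ?nth_nil // => /andP[/eqP size_s size_ss] lt_jk.
  by rewrite nth_cat size_s lt_jk.
by rewrite nth_cat size_s mulSn -addnA ltnNge leq_addr /= addKn IH.
Qed.

Lemma size_dist_codes :
  size [seq dist_code (D u v) | u <- enum 'I_n, v <- enum 'I_n] = n * n.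
Proof. by rewrite size_allpairs size_enum_ord. Qed.

Lemma nth_encode_dist (u v : 'I_n) :
  nth 0 (encode D es) (u * n + 2 + v) = dist_code (D u v).
Proof.
have lt_uv : u * n + v < n * n.
  by have := ltn_ord u; have := ltn_ord v; nia.
have -> : u * n + 2 + v = (u * n + v).+2 by lia.
rewrite /encode /= nth_cat size_dist_codes lt_uv.
rewrite (nth_flatten_const 0 (k := n)) ?ltn_ord //; last first.
  by apply/allP => s /mapP[w _ ->]; rewrite size_map size_enum_ord.
by rewrite (nth_map u) ?size_enum_ord // (nth_map v) ?size_enum_ord // !nth_ord_enum.
Qed.

Lemma nth_encode_ends j : nth 0 (encode D es) (n * n + 2 + j) =
  nth 0 (flatten [seq [:: nat_of_ord e.1; nat_of_ord e.2] | e <- es]) j.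
Proof.
have -> : n * n + 2 + j = (n * n + j).+2 by lia.
by rewrite /encode /= nth_cat size_dist_codes ltnNge leq_addr /= addKn.
Qed.

(** One edge occupies two cells and yields two arcs, so both lists are peeled two positions at a
    time. *)
Lemma nth_ends_src (u : 'I_n) j : j < m + m ->
  nth 0 (flatten [seq [:: nat_of_ord e.1; nat_of_ord e.2] | e <- es]) j =
  (arc es u j).1.
Proof.
rewrite /arc /arcs; elim: es j => [|e es' IH] [|[|j]] //= lt_j.
by apply: IH; lia.
Qed.

Lemma nth_ends_dst (u : 'I_n) j : j < m + m ->
  nth 0 (flatten [seq [:: nat_of_ord e.1; nat_of_ord e.2] | e <- es])
    (j + 1 - odd j - odd j) = (arc es u j).2.
Proof.
rewrite /arc /arcs; elim: es j => [|e es' IH] [|[|j]] //= lt_j.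
rewrite negbK -IH; last by lia.
by have -> : j.+2 + 1 - odd j - odd j = (j + 1 - odd j - odd j).+2 by lia.
Qed.

Lemma set2_inj (x y a b : 'I_n) :
  [set x; y] = [set a; b] -> (x, y) = (a, b) \/ (x, y) = (b, a).
Proof.
move=> eq_s.
have /set2P x_ab : x \in [set a; b] by rewrite -eq_s set21.
have /set2P y_ab : y \in [set a; b] by rewrite -eq_s set22.
have /set2P a_xy : a \in [set x; y] by rewrite eq_s set21.
have /set2P b_xy : b \in [set x; y] by rewrite eq_s set22.
by case: x_ab y_ab a_xy b_xy => -> [] -> [] ? [] ?; subst; auto.
Qed.

Lemma mem_arcs (x y : 'I_n) :
  reflect (exists2 e, e \in es & (x, y) = e \/ (x, y) = (e.2, e.1)) ((x, y) \in arcs es).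
Proof.
apply: (iffP flatten_mapP) => -[e e_es xy]; exists e => //.
  by move: xy; rewrite !inE => /orP[]/eqP; auto.
by rewrite !inE; case: xy => ->; rewrite eqxx ?orbT.
Qed.

Hypothesis es_edges : edge_list Gp es.

Lemma edges_arcs_es (x y : 'I_n) : ([set x; y] \in edges Gp) = ((x, y) \in arcs es).
Proof.
rewrite -mem_enum -(perm_mem es_edges); apply/mapP/mem_arcs => -[e e_es xy]; exists e => //.
  by case: e {e_es} xy => a b /set2_inj.
by case: e {e_es} xy => a b [[-> ->]|[-> ->]] //; rewrite setUC.
Qed.

Lemma size_edge_list : m = #|edges Gp|.
Proof. by rewrite cardE -(perm_size es_edges) size_map. Qed.

(** Distinct edges are listed as distinct pairs. This keeps the tables of length [m + m] within
    quadratic space. *)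
Lemma edge_list_le : m <= n * n.
Proof.
have es_uniq : uniq es.
  by apply: (@map_uniq _ _ (fun e : 'I_n * 'I_n => [set e.1; e.2]));
    rewrite (perm_uniq es_edges) enum_uniq.
by rewrite -(card_uniqP es_uniq) -[X in X * X]card_ord -card_prod max_card.
Qed.

End Encoding.

(** * Resource bounds and conclusion *)

Lemma solve_time_le (n : nat) (es : seq ('I_n * 'I_n)) :
  solve_time es <= 300 * time_bound n (size es).
Proof.
rewrite /solve_time /source_time /round_time /test_time /time_bound /=.
move: (leq_maxr 1 n) (leq_maxl 1 n) (leq_maxr 1 (size es)) (leq_maxl 1 (size es)).
move: (size es) (maxn 1 n) (maxn 1 (size es)) => m N M nN N1 mM M1.
have [h1 h2] : m * n <= M * N /\ m <= M * N by split; [exact: leq_mul|nia].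
have [h3 h4] : n <= M * N /\ 1 <= M * N by split; nia.
(* One source costs a combination of [m * n], [m], [n] and 1, each at most [M * N]. The slack
   between 250 and 300 pays for the setup and the last loop test. *)
set T := (X in n * X); have le_T : T <= 250 * (M * N) by rewrite /T; lia.
have := leq_mul nN le_T; have : 1 <= N * (M * N) by nia.
rewrite expnS expn1; lia.
Qed.

Theorem theorem3p15 :
  exists (p : prog) (c : nat),
    forall (n : nat) (D : 'M[option nat]_n) (Gp : sgraph n)
           (es : seq ('I_n * 'I_n)) (W : nat),
      distance_matrix D ->
      edge_list Gp es ->
      c * space_bound n <= W ->
      (forall x, x \in encode D es -> x < W) ->
      exists (t : nat) (s : state),
        [/\ exec W (c * space_bound n) p (init (encode D es)) t s,
            t <= c * time_bound n #|edges Gp|,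
            reg s 0 = `[< realizable D Gp >] &
            realizable D Gp ->
            exists G : tgraph n,
              [/\ realization D Gp G,
                  nlabels G <= n ^ 2 &
                  outputs (c * space_bound n) s G]].
Proof.
(* The constant comes from the time bound; for space, 14 times [maxn 1 n ^ 2] would do. *)
exists solve, 300 => n D Gp es W D_dist es_edges leW ltW.
have eW := edges_arcs_es es_edges; set S := 300 * _.
have space : n * n + 2 + (size es + size es) + n + (size es + size es)
    + 3 * (n * n) + 3 <= S.
  rewrite /S /space_bound expnS expn1.
  move: (edge_list_le es_edges) (leq_maxr 1 n) (leq_maxl 1 n).
  move: (size es) (maxn 1 n) => m N le_m le_n N1.
  have := leq_mul le_n le_n; have := leq_mul N1 (leqnn N); lia.
have inpW a : nth 0 (encode D es) a < W.
  have [lt_a|le_a] := ltnP a (size (encode D es)); first exact/ltW/mem_nth.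
  by rewrite nth_default //; clear - leW space; lia.
have inp_src u j : j < size es + size es ->
    nth 0 (encode D es) (n * n + 2 + j) = (arc es u j).1.
  by move=> lt_j; rewrite nth_encode_ends (nth_ends_src u lt_j).
have inp_dst u j : j < size es + size es ->
    nth 0 (encode D es) (n * n + 2 + j + 1 - odd j - odd j) = (arc es u j).2.
  move=> lt_j; rewrite -(nth_ends_dst u lt_j) -(nth_encode_ends D es).
  by congr (nth _ _ _); clear; lia.
have [t [s [ex le_t [b [out [r [mm [es_eq B _ [ok sz] [snd cpl]]]]]]]]]
  := wp_solve D_dist space leW inpW erefl erefl
  (nth_encode_dist D es) inp_src inp_dst eW.
rewrite {}es_eq in ex.
(* This serves twice: it shows that a positive answer is correct, and it supplies the realization to
   be output. *)
have real_out : b -> exists G : tgraph n,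
    [/\ realization D Gp G, nlabels G <= n ^ 2 & label_list G out].
  move=> bT; have [|G Gout sG] := @label_list_exists n Gp out.
    move=> l /ok[l_arc l_gt0 _]; rewrite eW l_gt0 andbT.
    by rewrite -surjective_pairing.
  exists G; split=> //; last first.
    by apply: leq_trans (nlabels_le_size Gout) _; rewrite expnS expn1.
  split=> //; apply: (compat_realizes D_dist) => [x y q|u v q Duv].
    (* A label list fixes edges only as unordered pairs, so the listed orientation may be the
       reverse one. *)
    rewrite (label_list_tedge _ _ _ Gout) => /mapP[l /ok[_ _ cl] [eq_xy ->]].
    by case: (set2_inj eq_xy) => -[-> ->] //; rewrite compat_sym.
  apply: twalk_sub (snd bT u v q (ltn_ord u) Duv) => x y i.
  by rewrite (label_list_tedge _ _ _ Gout).
exists t, (State r mm); split=> //=.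
- by rewrite -(size_edge_list es_edges); exact: leq_trans le_t (solve_time_le es).
- rewrite (base0 B); congr nat_of_bool; apply/idP/asboolP => // /real_out[G [Greal _ _]].
  by exists G.
- move=> /cpl/real_out[G [Greal le_n Gout]]; exists G; split=> //.
  exists out; rewrite /= (base2 B) (base1 B); split=> //; last exact: (base_out B).
  by clear - space sz; lia.
Qed.
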